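(* Let $k\ge 2$ be an integer and let $H=(V,E)$ be a hypergraph all of whose edges have size $k$ or $k+1$. Define $g(e)=p=\frac{1}{k-1+1/k}$ if $|e|=k$ and $g(e)=q=\frac{1}{k+1/k}$ if $|e|=k+1$. Then no basic fractional matching of $H$ is stuck for $g$.
   Context: A hypergraph $H=(V,E)$ has finite vertex set $V$ and a finite set $E$ of nonempty subsets of $V$. For an edge $e$, $N(e)=\{f\in E: f\neq e,\ f\cap e\neq\emptyset\}$. A fractional matching of $H$ is $x:E\to[0,1]$ with $\sum_{e\ni v}x(e)\le 1$ for all $v\in V$; it is basic if it is an extreme point of the fractional matching polytope of $H$. A basic fractional matching $x$ is stuck for $g:E\to\mathbb{R}$ if for every $e\in E$, $\sum_{f\in N(e)}g(f)x(f)>1-g(e)x(e)$.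
   Formalization: The hypergraph is assumed to have at least one edge; with no edges the unique (empty) fractional matching is basic and vacuously stuck, so the claim fails there. *)

(* Defs.v *)
From HB Require Import structures.
From mathcomp Require Import all_boot all_order all_algebra.
From mathcomp Require Import reals.

Set Implicit Arguments.
Unset Strict Implicit.
Unset Printing Implicit Defensive.

Import Order.TTheory GRing.Theory Num.Theory.
Local Open Scope ring_scope.

Record hypergraph (V : finType) := Hypergraph {
  edges : {set {set V}};
  edges_neq0 : set0 \notin edges }.

Definition edge (V : finType) (H : hypergraph V) := {e : {set V} | e \in edges H}.

Definition edge_nbhd (V : finType) (H : hypergraph V) (e : edge H) :
    {set edge H} :=
  [set f : edge H | (f != e) && (val f :&: val e != set0)].

Definition extreme_point (R : numDomainType) (L : lmodType R)
    (P : L -> Prop) (x : L) : Prop :=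
  P x /\
  forall (y z : L) (t : R), P y -> P z -> 0 < t < 1 ->
    x = t *: y + (1 - t) *: z -> y = z.

(* R^o is R as a module over itself, so that {ffun edge H -> R^o} is the
   R-vector space R^E in which the extreme points are taken. *)
Definition fractional_matching (R : realType) (V : finType) (H : hypergraph V)
    (x : {ffun edge H -> R^o}) : Prop :=
  (forall e : edge H, 0 <= x e <= 1) /\
  (forall v : V, \sum_(e : edge H | v \in val e) x e <= 1).

Definition basic_fractional_matching (R : realType) (V : finType)
    (H : hypergraph V) (x : {ffun edge H -> R^o}) : Prop :=
  extreme_point (@fractional_matching R V H) x.

Definition stuck (R : realType) (V : finType) (H : hypergraph V)
    (g : edge H -> R) (x : {ffun edge H -> R^o}) : Prop :=
  forall e : edge H, \sum_(f in edge_nbhd e) g f * x f > 1 - g e * x e.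

(* Main.v *)
(* Suppose x is basic and stuck. Let A v and B v be the x-mass at the vertex v
   of the edges of size k and k + 1, and put D = k^2 - k + 1, r = k^2 / D.
   Bounding the sum over N(e) by the sum over the vertices of e and using
   A + B <= 1, stuckness gives for every e in the support of x
     x(e) * sum_(v in e) (1 + r B v) < 1   if e has size k,
     x(e) * sum_(v in e) (1 - r A v) < 1   if e has size k + 1.
   Summing over the support, the cross terms r A v B v cancel, so the sum of
   A v + B v over all v is less than the size of the support. That sum is at
   least the number of saturated vertices, which for a basic x is at least the
   size of the support: a contradiction. *)
Require Import Defs.
From HB Require Import structures.
From mathcomp Require Import all_boot all_order all_algebra.
From mathcomp Require Import reals.
From mathcomp Require Import ring lra.

Set Implicit Arguments.
Unset Strict Implicit.
Unset Printing Implicit Defensive.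

Import Order.TTheory GRing.Theory Num.Theory.
Local Open Scope ring_scope.

(** With [a] the slacks of finitely many constraints and [b] their changes along a direction that
    keeps tight constraints tight, a short enough step either way stays feasible. *)
Lemma exists_small_scaling (R : realFieldType) (I : finType) (a b : I -> R) :
  (forall i, 0 <= a i) -> (forall i, a i = 0 -> b i = 0) ->
  exists2 t : R, 0 < t & forall i, `|t * b i| <= a i.
Proof.
move=> a_ge0 ab0; set s := \sum_i `|b i| / a i.
have term_ge0 i : 0 <= `|b i| / a i by rewrite divr_ge0.
(* The witness is [1 / (1 + s)]: each ratio is at most [s], and adding 1 keeps the denominator
   positive even if [b] vanishes. Ratios with [a i = 0] are 0 by the convention for division by
   zero. *)
have s1_gt0 : 0 < 1 + s by rewrite ltr_wpDr ?ltr01 ?sumr_ge0.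
exists (1 + s)^-1; first by rewrite invr_gt0.
move=> i; rewrite normrM gtr0_norm ?invr_gt0 // mulrC ler_pdivrMr //.
have [/eqP a0|an0] := boolP (a i == 0); first by rewrite a0 ab0 // normr0 mul0r.
rewrite -ler_pdivrMl ?lt0r ?an0 ?a_ge0 // mulrC.
rewrite /s (bigD1 i) //= addrCA lerDl addr_ge0 ?ler01 // sumr_ge0 //.
Qed.

(** With more unknowns than equations, the coefficient matrix has a nonzero vector in its left
    kernel; [d] extends it by zero outside [W]. *)
Lemma exists_nonzero_solution (F : fieldType) (I J : finType)
    (W : {set I}) (T : {set J}) (a : I -> J -> F) :
  (#|T| < #|W|)%N ->
  exists d : I -> F, [/\ exists i, d i != 0, forall i, i \notin W -> d i = 0
    & forall j, j \in T -> \sum_i d i * a i j = 0].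
Proof.
move=> ltTW.
pose A := \matrix_(i < #|W|, j < #|T|) a (enum_val i) (enum_val j).
have kerA_neq0 : kermx A != 0.
  rewrite kermx_eq0 /row_free neq_ltn.
  by rewrite (leq_ltn_trans (rank_leq_col A) ltTW).
have [u /sub_kermxP uA0 u_neq0] := rowV0Pn kerA_neq0.
pose d i := \sum_(l < #|W|) u 0 l * (enum_val l == i)%:R.
have dE l : d (enum_val l) = u 0 l.
  rewrite /d (bigD1 l) //= eqxx mulr1 big1 ?addr0 // => m m_neq_l.
  by rewrite (inj_eq enum_val_inj) (negPf m_neq_l) mulr0.
have d0 i : i \notin W -> d i = 0.
  move=> iNW; rewrite /d big1 // => l _; have [eli|] := eqVneq; last by rewrite mulr0.
  by rewrite -eli enum_valP in iNW.
exists d; split=> // [|j jT].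
  have [l ul_neq0] := rV0Pn _ u_neq0.
  by exists (enum_val l); rewrite dE.
rewrite (bigID (mem W)) /= [X in _ + X]big1 ?addr0; last first.
  by move=> i /d0 ->; rewrite mul0r.
rewrite big_enum_val /=.
have /rowP/(_ (enum_rank_in jT j)) := uA0; rewrite !mxE; apply: etrans.
by apply: eq_bigr => l _; rewrite dE mxE enum_rankK_in.
Qed.

Lemma fractional_matching_add (R : realType) (V : finType) (H : hypergraph V)
    (x : {ffun edge H -> R^o}) (d : edge H -> R) :
  (forall e, `|d e| <= x e) ->
  (forall v, `|\sum_(e : edge H | v \in val e) d e|
    <= 1 - \sum_(e : edge H | v \in val e) x e) ->
  fractional_matching [ffun e => x e + d e].
Proof.
move=> dx dv.
have y_ge0 e : 0 <= x e + d e.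
  by rewrite -lerBlDl sub0r; have := dx e; rewrite ler_norml => /andP[].
have y_le1 v : \sum_(e : edge H | v \in val e) (x e + d e) <= 1.
  by rewrite big_split /= -lerBrDl; apply: le_trans (dv v); apply: ler_norm.
split=> [e|v]; last by under eq_bigr do rewrite ffunE; exact: y_le1.
rewrite ffunE y_ge0 /=.
(* The bound by 1 on a single edge follows from the constraint at any of its vertices, since edges
   are nonempty. *)
have /set0Pn[v ve] : val e != set0.
  by apply: contraNneq (edges_neq0 H) => <-; apply: valP.
apply: le_trans (y_le1 v); rewrite (bigD1 e) //= lerDl sumr_ge0 //.
Qed.

(** Otherwise some nonzero [d] supported on the support of [x] has sum zero at every saturated
    vertex. Then [x] is the midpoint of the fractional matchings [x + t d] and [x - t d], against
    extremality. *)
Lemma basic_card_support_le (R : realType) (V : finType) (H : hypergraph V)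
    (x : {ffun edge H -> R^o}) :
  basic_fractional_matching x ->
  (#|[set e | x e != 0]%R|
    <= #|[set v : V | \sum_(e : edge H | v \in val e) x e == 1]%R|)%N.
Proof.
case=> [[x01 xv] x_extr]; rewrite leqNgt; apply/negP => ltTW.
have [d [[e0 de0] d0 dT]] :=
  exists_nonzero_solution (fun (e : edge H) v => (v \in val e)%:R : R) ltTW.
have dv v : \sum_(e : edge H | v \in val e) x e = 1 ->
    \sum_(e : edge H | v \in val e) d e = 0.
  move=> xv1; rewrite -[RHS](dT v) ?inE ?xv1 ?eqxx // big_mkcond /=.
  by apply: eq_bigr => e _; case: ifP; rewrite ?mulr1 ?mulr0.
have x_ge0 e : 0 <= x e by have /andP[] := x01 e.
(* Edge and vertex constraints are indexed together, so that one [t] suits them all. *)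
pose a (i : edge H + V) : R := match i with
  | inl e => x e | inr v => 1 - \sum_(e : edge H | v \in val e) x e end.
pose b (i : edge H + V) : R := match i with
  | inl e => d e | inr v => \sum_(e : edge H | v \in val e) d e end.
have [||t t_gt0 tab] := @exists_small_scaling R _ a b.
- by case=> [e|v] /=; [exact: x_ge0 | rewrite subr_ge0; exact: xv].
- case=> [e|v] /= => [xe0|/eqP]; first by rewrite d0 // inE xe0 eqxx.
  by rewrite subr_eq0 => /eqP/esym; exact: dv.
have feas c : `|c| = t -> fractional_matching [ffun e => x e + c * d e].
  move=> ct; apply: fractional_matching_add => [e|v].
    by have := tab (inl e); rewrite /= !normrM ct gtr0_norm.
  by have := tab (inr v); rewrite /= -mulr_sumr !normrM ct gtr0_norm.
have half : 0 < (2^-1 : R) < 1 by apply/andP; split; lra.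
have mid : x = 2^-1 *: [ffun e => x e + t * d e]
    + (1 - 2^-1) *: [ffun e => x e + - t * d e] :> {ffun edge H -> R^o}.
  apply/ffunP => e; rewrite !ffunE /GRing.scale /=.
  by move: (x e : R) (d e) => xe de; field.
have /ffunP/(_ e0) := x_extr _ _ _ (feas t (gtr0_norm t_gt0))
  (feas (- t) (etrans (normrN _) (gtr0_norm t_gt0))) half mid.
rewrite !ffunE => /addrI/eqP.
rewrite -subr_eq0 mulNr opprK -mulr2n mulrn_eq0 /= mulf_eq0 (gt_eqF t_gt0) /=.
by rewrite (negPf de0).
Qed.

(** The right-hand side counts each edge [f] with multiplicity equal to the size of its intersection
    with [e]: at least 1 for a neighbour, and the size of [e] for [e] itself. *)
Lemma nbhd_sum_le (R : realType) (V : finType) (H : hypergraph V)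
    (w : edge H -> R) (e : edge H) :
  (forall f, 0 <= w f) ->
  \sum_(f in edge_nbhd e) w f + w e *+ #|val e|
    <= \sum_(v in val e) \sum_(f : edge H | v \in val f) w f.
Proof.
move=> w_ge0.
have -> : \sum_(v in val e) \sum_(f : edge H | v \in val f) w f =
    \sum_(f : edge H) w f *+ #|val f :&: val e|.
  rewrite (exchange_big_dep xpredT) //=; apply: eq_bigr => f _.
  by rewrite -sumr_const; apply: eq_bigl => v; rewrite inE andbC.
rewrite [leRHS](bigD1 e) //= setIid [leLHS]addrC lerD2l.
rewrite [leRHS](bigID (fun f => f \in edge_nbhd e)) /= -[leLHS]addr0.
apply: lerD; last by rewrite sumr_ge0 // => f _; rewrite mulrn_wge0.
rewrite [leRHS](eq_bigl (mem (edge_nbhd e))); last first.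
  by move=> f; rewrite /= inE; case: (f != e).
apply: ler_sum => f; rewrite inE => /andP[_]; rewrite -card_gt0 => c_gt0.
by rewrite -[leLHS]mulr1n ler_wpMn2l.
Qed.

(* [k / (k ^+ 2 - k + 1)] and [k / (k ^+ 2 + 1)] are the weights p and q; S is
   the sum of [B v] over the edge, and of [A v] in [stuck_bound_size_k1]. *)
Lemma stuck_bound_size_k (R : realFieldType) (k x S : R) :
  2 <= k -> 0 < x -> 0 <= S ->
  1 < k / (k ^+ 2 - k + 1) * (k - (k - 1) * x)
      - (k / (k ^+ 2 - k + 1) - k / (k ^+ 2 + 1)) * S ->
  x * (k + k ^+ 2 / (k ^+ 2 - k + 1) * S) < 1.
Proof.
move=> k2 x0 S0.
have D0 : 0 < k ^+ 2 - k + 1 by nra.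
have E0 : 0 < k ^+ 2 + 1 by nra.
set D := k ^+ 2 - k + 1 in D0 *; set E := k ^+ 2 + 1 in E0 *.
move=> h.
(* With this [y] the goal reads [k x (1 + y) < 1]; it follows from [k x < 1 - y], because
   [(1 - y) (1 + y) <= 1]. *)
pose y := k * S / D.
have y0 : 0 <= y by rewrite /y divr_ge0 ?mulr_ge0 //; lra.
have Sy : k * S = D * y by rewrite /y; field; lra.
have -> : x * (k + k ^+ 2 / D * S) = k * x * (1 + y) by rewrite /y; field; lra.
have {}h : k ^+ 2 * S + k * (k - 1) * E * x < (k - 1) * E.
  rewrite -subr_gt0.
  have -> : (k - 1) * E - (k ^+ 2 * S + k * (k - 1) * E * x) =
     D * E * (k / D * (k - (k - 1) * x) - (k / D - k / E) * S - 1).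
    by rewrite /D /E; field; rewrite -/D -/E !gt_eqF.
  by rewrite !mulr_gt0 // subr_gt0.
have kx : k * x < 1 - y.
  have kE : 0 < (k - 1) * E by rewrite mulr_gt0 //; lra.
  rewrite -(ltr_pM2l kE).
  (* Here [k ^+ 2 * S = k * D * y], and [k * D] exceeds [(k - 1) * E] by exactly 1. *)
  have : (k - 1) * E * y <= k ^+ 2 * S.
    have -> : k ^+ 2 * S = k * D * y by rewrite -[RHS]mulrA -Sy mulrA expr2.
    apply: ler_wpM2r => //.
    by rewrite /D /E -subr_ge0; have -> : k * (k ^+ 2 - k + 1) - (k - 1) * (k ^+ 2 + 1) = 1 by ring.
  lra.
apply: (@lt_le_trans _ _ ((1 - y) * (1 + y))); last by nra.
by rewrite ltr_pM2r //; lra.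
Qed.

Lemma stuck_bound_size_k1 (R : realFieldType) (k x S : R) :
  2 <= k -> 0 < x ->
  1 < k / (k ^+ 2 + 1) * (k + 1 - k * x)
      + (k / (k ^+ 2 - k + 1) - k / (k ^+ 2 + 1)) * S ->
  x * (k + 1 - k ^+ 2 / (k ^+ 2 - k + 1) * S) < 1.
Proof.
move=> k2 x0.
have D0 : 0 < k ^+ 2 - k + 1 by nra.
have E0 : 0 < k ^+ 2 + 1 by nra.
set D := k ^+ 2 - k + 1 in D0 *; set E := k ^+ 2 + 1 in E0 *.
move=> h; set z := k ^+ 2 / D * S.
(* Multiply the hypothesis by [E]; since [E - D = k], the coefficient of [S] becomes
   [k ^+ 2 / D]. *)
have {}h : k ^+ 2 * x < k - 1 + z.
  rewrite -subr_gt0.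
  have -> : k - 1 + z - k ^+ 2 * x =
     E * (k / E * (k + 1 - k * x) + (k / D - k / E) * S - 1).
    by rewrite /z /D /E; field; rewrite -/D -/E !gt_eqF.
  by rewrite mulr_gt0 // subr_gt0.
(* For [z >= k + 1] the product is nonpositive; otherwise the bound on [x] may be multiplied by
   [k + 1 - z > 0]. *)
have [z_big|z_small] := lerP (k + 1) z.
  by apply: le_lt_trans ltr01; rewrite mulr_ge0_le0 ?(ltW x0) ?subr_le0.
have k0 : 0 < k ^+ 2 by nra.
rewrite -(ltr_pM2l k0) mulr1 mulrA.
apply: (@lt_le_trans _ _ ((k - 1 + z) * (k + 1 - z))).
  by rewrite ltr_pM2r // subr_gt0.
(* AM-GM: the two factors have sum [2 k]. *)
by have := sqr_ge0 (1 - z); nra.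
Qed.

Theorem theorem18 (R : realType) (k : nat) (V : finType) (H : hypergraph V)
    (g : edge H -> R) :
  (2 <= k)%N ->
  edges H != set0 ->
  (forall e : edge H, #|val e| = k \/ #|val e| = k.+1) ->
  (forall e : edge H, #|val e| = k -> g e = 1 / (k%:R - 1 + 1 / k%:R)) ->
  (forall e : edge H, #|val e| = k.+1 -> g e = 1 / (k%:R + 1 / k%:R)) ->
  forall x : {ffun edge H -> R^o},
    basic_fractional_matching x -> ~ stuck g x.
Proof.
move=> k_ge2 /set0Pn[e0 e0H] cardE gk gk1 x x_basic x_stuck.
have leWT := basic_card_support_le x_basic.
have {x_basic} [[x01 xv] _] := x_basic.
(* The same weights, typed in [R] instead of the module [R^o]: from here on only real inequalities
   matter. *)
pose y (e : edge H) : R := x e.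
have y_ge0 (e : edge H) : 0 <= y e by have /andP[] := x01 e.
have {x01}yv v : \sum_(e : edge H | v \in val e) y e <= 1 by exact: xv.
have {xv} ystuck (e : edge H) : 1 - g e * y e < \sum_(f in edge_nbhd e) g f * y f.
  exact: x_stuck.
have {x_stuck}leWT : (#|[set e | y e != 0]%R| <=
    #|[set v : V | \sum_(e : edge H | v \in val e) y e == 1]%R|)%N := leWT.
move: y y_ge0 yv ystuck leWT => {}x x_ge0 xv x_stuck leWT.
have K2 : 2 <= k%:R :> R by rewrite ler_nat.
set K : R := k%:R in gk gk1 K2.
have D0 : 0 < K ^+ 2 - K + 1 by nra.
have E0 : 0 < K ^+ 2 + 1 by nra.
set p := K / (K ^+ 2 - K + 1).
set q := K / (K ^+ 2 + 1).
have {}gk (e : edge H) : #|val e| = k -> g e = p.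
  by move=> /gk ->; rewrite /p; field; rewrite !gt_eqF //; lra.
have {}gk1 (e : edge H) : #|val e| = k.+1 -> g e = q.
  by move=> /gk1 ->; rewrite /q; field; rewrite !gt_eqF //; lra.
have q_ge0 : 0 <= q by rewrite divr_ge0 ?ltW //; lra.
have le_qp : q <= p.
  by rewrite /q /p ler_pM2l ?lef_pV2 ?posrE //; lra.
have cardN (e : edge H) : #|val e| != k -> #|val e| = k.+1.
  by case: (cardE e) => // ->; rewrite eqxx.
have gN (e : edge H) : #|val e| != k -> g e = q by move=> /cardN /gk1.
have g_ge0 (e : edge H) : 0 <= g e.
  by case: (cardE e) => [/gk|/gk1] -> //; apply: le_trans le_qp.
pose A v := \sum_(e : edge H | (v \in val e) && (#|val e| == k)) x e.
pose B v := \sum_(e : edge H | (v \in val e) && (#|val e| != k)) x e.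
have xvE v : \sum_(e : edge H | v \in val e) x e = A v + B v.
  by rewrite (bigID (fun e : edge H => #|val e| == k)).
have B_ge0 v : 0 <= B v by rewrite sumr_ge0.
have A_ge0 v : 0 <= A v by rewrite sumr_ge0.
have AB_le1 v : A v + B v <= 1 by rewrite -xvE.
have gxvE v : \sum_(e : edge H | v \in val e) g e * x e = p * A v + q * B v.
  rewrite (bigID (fun e : edge H => #|val e| == k)) /= !mulr_sumr.
  congr (_ + _); apply: eq_bigr => e /andP[_].
    by move=> /eqP/gk ->.
  by move=> /gN ->.
have local_lt (e : edge H) :
    1 - g e * x e + g e * x e *+ #|val e| < \sum_(v in val e) (p * A v + q * B v).
  rewrite -(eq_bigr _ (fun v _ => gxvE v)).
  apply: lt_le_trans (nbhd_sum_le e (fun f => mulr_ge0 (g_ge0 f) (x_ge0 f))).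
  by rewrite ltrD2r.
pose r := K ^+ 2 / (K ^+ 2 - K + 1).
pose c (e : edge H) v := if #|val e| == k then 1 + r * B v else 1 - r * A v.
have edge_lt (e : edge H) : x e != 0 -> x e * \sum_(v in val e) c e v < 1.
  move=> xe_neq0; have xe_gt0 : 0 < x e by rewrite lt0r xe_neq0 x_ge0.
  rewrite /c; have := local_lt e; have [ek|eNk] := boolP (#|val e| == k).
    rewrite (gk _ (eqP ek)) (eqP ek) -mulr_natr -/K => lt_e.
    rewrite big_split /= sumr_const (eqP ek) -mulr_sumr -/K.
    apply: stuck_bound_size_k => //; first by rewrite sumr_ge0.
    (* The vertex constraint gives [A v <= 1 - B v], which eliminates [A v]. *)
    have : \sum_(v in val e) (p * A v + q * B v) <=
        \sum_(v in val e) (p - (p - q) * B v).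
      apply: ler_sum => v _; rewrite -subr_ge0.
      have -> : p - (p - q) * B v - (p * A v + q * B v) = p * (1 - (A v + B v)) by ring.
      by rewrite mulr_ge0 ?subr_ge0 // (le_trans q_ge0).
    rewrite [leRHS]big_split /= sumr_const (eqP ek) sumrN -mulr_sumr -mulr_natr -/K.
    rewrite -/p -/q; move: lt_e; clear; lra.
  rewrite (gN _ eNk) (cardN _ eNk) -mulr_natr -natr1 -/K => lt_e.
  rewrite sumrB sumr_const (cardN _ eNk) -mulr_sumr -natr1 -/K.
  apply: stuck_bound_size_k1 => //.
  (* Now [B v <= 1 - A v] eliminates [B v], so the gain [p - q] falls on [A v]. *)
  have : \sum_(v in val e) (p * A v + q * B v) <=
      \sum_(v in val e) (q + (p - q) * A v).
    apply: ler_sum => v _; rewrite -subr_ge0.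
    have -> : q + (p - q) * A v - (p * A v + q * B v) = q * (1 - (A v + B v)) by ring.
    by rewrite mulr_ge0 ?subr_ge0.
  rewrite [leRHS]big_split /= sumr_const (cardN _ eNk) -mulr_sumr -mulr_natr -natr1 -/K.
  rewrite -/p -/q; move: lt_e; clear; lra.
have double_count : \sum_e x e * (\sum_(v in val e) c e v) = \sum_v (A v + B v).
  under eq_bigr do rewrite mulr_sumr.
  rewrite (exchange_big_dep xpredT) //=; apply: eq_bigr => v _.
  have -> : A v + B v = A v * (1 + r * B v) + B v * (1 - r * A v) by ring.
  rewrite (bigID (fun e : edge H => #|val e| == k)) /= !mulr_suml.
  by congr (_ + _); apply: eq_bigr => e /andP[_]; rewrite /c; [move=> -> | move=> /negPf ->].
set W := [set e | _] in leWT; set T := [set v | _] in leWT.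
(* A strict inequality between sums needs a nonempty support: for [x = 0], stuckness at [e0] would
   say [1 < 0]. *)
have [e1 e1W] : exists e, e \in W.
  apply/existsP; apply: contraT; rewrite negb_exists => /forallP WN.
  have x0 (e : edge H) : x e = 0 by apply/eqP; have := WN e; rewrite inE negbK.
  have := x_stuck (exist _ e0 e0H); rewrite x0 mulr0 subr0 big1 ?ltr10 //.
  by move=> f _; rewrite x0 mulr0.
have : \sum_e x e * (\sum_(v in val e) c e v) < #|W|%:R.
  rewrite (bigID (mem W)) /= [X in _ + X]big1 ?addr0; last first.
    by move=> e; rewrite inE negbK => /eqP ->; rewrite mul0r.
  rewrite -sum1_card natr_sum; apply: ltr_sum => [|e].
    by apply/hasP; exists e1; rewrite ?mem_index_enum.
  by rewrite inE; apply: edge_lt.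
apply/negP; rewrite -leNgt double_count.
apply: (@le_trans _ _ #|T|%:R); first by rewrite ler_nat.
(* Each saturated vertex contributes exactly 1 to the sum of [A v + B v], every other vertex a
   nonnegative amount. *)
rewrite -sum1_card natr_sum [leRHS](bigID (mem T)) /= -[leLHS]addr0.
apply: lerD; last by rewrite sumr_ge0 // => v _; rewrite addr_ge0.
by apply: ler_sum => v; rewrite inE xvE => /eqP ->.
Qed.
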